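(* Assume that (i) the $\mathbb{P}$-essential infimum of $V$ is $0$ and the $\mathbb{P}$-essential supremum of $V$ is $1$, and (ii) for every $h\in(0,1)$ and $\ell\in\mathbb{N}$, $\mathbb{P}(V(T_y\omega)\le h \text{ for all } y\in\{0,\ldots,\ell\})>0$ and $\mathbb{P}(V(T_y\omega)\ge h \text{ for all } y\in\{0,\ldots,\ell\})>0$. Let $\delta=0$, $\beta>0$ and $\theta\in\mathbb{R}$. Then for $\mathbb{P}$-a.e. $\omega$ the limit $$u_o(t,x\,|\,0,\beta,\theta)=\lim_{\epsilon\to0}\epsilon\, u([\epsilon^{-1}t],[\epsilon^{-1}x],\omega\,|\,0,\beta,\theta)$$ exists for every $t>0$ and $x\in\mathbb{R}$. Moreover, $u_o(t,x\,|\,0,\beta,\theta)=t\,\overline H_{0,\beta}(\theta)+\theta x$, where the effective Hamiltonian $\overline H_{0,\beta}(\theta):=u_o(1,0\,|\,0,\beta,\theta)$ is a deterministic quantity given by $$\overline H_{0,\beta}(\theta)=\Lambda_\beta(\theta):=\lim_{n\to\infty}\frac1n\log E_0\left[e^{\beta\sum_{i=0}^{n-1}V(T_{X_i}\omega)+\theta X_n}\right].$$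
   Context: $(\Omega,\mathcal{F},\mathbb{P})$ is a probability space equipped with an ergodic invertible measure-preserving transformation $T:\Omega\to\Omega$; $T_0=I$, $T_k=T\circ T_{k-1}$ and $T_{-k}=(T_k)^{-1}$ for $k\in\mathbb{N}=\{1,2,\ldots\}$. $V:\Omega\to[0,1]$ is a nonconstant measurable function. $[\cdot]$ denotes the floor function. $P_x$ and $E_x$ denote probability and expectation for simple symmetric random walk $(X_i)_{i\ge0}$ on $\mathbb{Z}$ started at $X_0=x$ (independent of $\omega$). In general, for $\delta\in[0,1]$, $u(n,x,\omega\,|\,\delta,\beta,\theta)$ is the infimum, over Markov nearest-neighbor random walk policies with drift bounded in magnitude by $\delta$, of the logarithm of the expectation of $e^{\beta\sum_{i=0}^{n-1}V(T_{X_i}\omega)+\theta X_n}$ for the walk started at $x$. For $\delta=0$ there is only one policy (simple symmetric random walk), so for $n\in\mathbb{N}$, $x\in\mathbb{Z}$, $$u(n,x,\omega\,|\,0,\beta,\theta)=\log E_x\left[e^{\beta\sum_{i=0}^{n-1}V(T_{X_i}\omega)+\theta X_n}\right].$$ *)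

(* Defs.v *)
From HB Require Import structures.
From mathcomp Require Import all_boot all_order all_algebra.
From mathcomp Require Import all_classical all_reals all_analysis.

Set Implicit Arguments.
Unset Strict Implicit.
Unset Printing Implicit Defensive.

Import Order.TTheory GRing.Theory Num.Theory.
Import numFieldNormedType.Exports.

Local Open Scope classical_set_scope.
Local Open Scope ring_scope.

Section Dynamics.
Context {d : measure_display} {Omega : measurableType d} {R : realType}.
Variable P : probability Omega R.

Definition measure_preserving (T : Omega -> Omega) : Prop :=
  measurable_fun setT T /\
  forall A : set Omega, measurable A -> P (T @^-1` A) = P A.

Definition ergodic (T : Omega -> Omega) : Prop :=
  forall A : set Omega, measurable A -> T @^-1` A = A ->
    P A = 0%E \/ P A = 1%E.

(* [Tinv] is meant to be a two-sided inverse of [T]; recall that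
   [Negz n] denotes the integer [- (n + 1)]. *)
Definition iterz (T Tinv : Omega -> Omega) (k : int) : Omega -> Omega :=
  match k with
  | Posz n => iter n T
  | Negz n => iter n.+1 Tinv
  end.

End Dynamics.

Section Walk.
Context {R : realType}.

(* A trajectory of [n] nearest-neighbor steps is encoded by its sequence of
   steps, [true] being [+1]; [walk_path x s i] is the position at time
   [i <= n] (the path is frozen after time [n]). *)
Definition walk_step (b : bool) : int := if b then 1 else -1.

Definition walk_path (n : nat) (x : int) (s : {ffun 'I_n -> bool}) (i : nat)
  : int := x + \sum_(j < n | (j < i)%N) walk_step (s j).

(* E_x[F(X_0, ..., X_n)] for the simple symmetric random walk: the 2^n step
   sequences are equiprobable. *)
Definition ssrw_expectation (n : nat) (x : int) (F : (nat -> int) -> R) : R :=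
  (2 ^+ n)^-1 * \sum_(s : {ffun 'I_n -> bool}) F (walk_path x s).

(* A Markov policy prescribes the drift [a i y] of the next step when the walk
   is at [y] at time [i]. *)
Definition policies (delta : R) : set (nat -> int -> R) :=
  [set a | forall i y, `|a i y| <= delta].

(* The step [+1] (resp. [-1]) from [y] at time [i] has probability
   [(1 + a i y) / 2] (resp. [(1 - a i y) / 2]), so that its mean is [a i y]. *)
Definition policy_expectation (a : nat -> int -> R) (n : nat) (x : int)
    (F : (nat -> int) -> R) : R :=
  \sum_(s : {ffun 'I_n -> bool})
    (\prod_(i < n) ((1 + (walk_step (s i))%:~R * a i (walk_path x s i)) / 2))
    * F (walk_path x s).

End Walk.

Section Hamiltonian.
Context {d : measure_display} {Omega : measurableType d} {R : realType}.
Variables (T Tinv : Omega -> Omega) (V : Omega -> R).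

Definition path_weight (beta theta : R) (n : nat) (omega : Omega)
    (X : nat -> int) : R :=
  expR (beta * (\sum_(i < n) V (iterz T Tinv (X i) omega))
        + theta * (X n)%:~R).

Definition u (n : nat) (x : int) (omega : Omega) (delta beta theta : R) : R :=
  inf [set ln (policy_expectation a n x (path_weight beta theta n omega))
      | a in policies delta].

(* For [0 < t] and [0 < eps], [Num.truncn (eps^-1 * t)] is the floor of
   [eps^-1 * t], as a natural number. *)
Definition scaled_u (omega : Omega) (delta beta theta t x eps : R) : R :=
  eps * u (Num.truncn (eps^-1 * t)) (Num.floor (eps^-1 * x)) omega
          delta beta theta.

Definition u_o (omega : Omega) (delta beta theta t x : R) : R :=
  lim (scaled_u omega delta beta theta t x eps @[eps --> 0^'+]).

Definition effective_hamiltonian (omega : Omega) (delta beta theta : R) : R :=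
  u_o omega delta beta theta 1 0.

Definition log_moment (omega : Omega) (beta theta : R) (n : nat) : R :=
  n%:R^-1 * ln (ssrw_expectation n 0 (path_weight beta theta n omega)).

Definition Lambda (omega : Omega) (beta theta : R) : R :=
  lim (log_moment omega beta theta n @[n --> \oo]).

End Hamiltonian.

(* Main.v *)
(** Write [A f y = exp (beta * V_y) * (f (y + 1) + f (y - 1)) / 2], so that the
    expectation in the theorem is [Z_n x = A^n exp(theta .) x], and suppose
    [theta >= 0] (the other sign follows by reflecting the walk). For each
    [lambda > beta], the equation [A h = exp lambda * h] has a positive
    nondecreasing solution whose successive ratios are the values along the
    orbit of [omega] of one bounded function; by the ergodic theorem
    [ln (h y) = alpha * y + o(y)]. As [A^n 1 <= exp (n * beta)], comparing the
    initial condition [exp (theta * y)] near [x] with [h y / h x + 1] gives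
    [ln (Z_n x) <= n * lambda + theta * x + o(n)] when [alpha > theta], and
    comparing it with [h y / h x - 1] gives the opposite inequality when
    [alpha <= theta]. The inequality
    [ln (Z_n x) >= n * beta + theta * x - o(n)] comes from walks that reach one
    of the long hills of [V], which have positive density, and stay there. Hence
    [ln (Z_n x) = n * H + theta * x + o(n)] uniformly on [|x| <= C * n], where [H]
    is the supremum of [beta] and of those [lambda > beta] with
    [alpha <= theta]. *)
Require Import Defs.
From HB Require Import structures.
From mathcomp Require Import all_boot all_order all_algebra.
From mathcomp Require Import all_classical all_reals all_analysis.
From mathcomp Require Import ess_sup_inf.
From mathcomp Require Import measurable_realfun.
From mathcomp Require Import ring lra zify.

Set Implicit Arguments.
Unset Strict Implicit.
Unset Printing Implicit Defensive.

Import Order.TTheory GRing.Theory Num.Theory.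
Import numFieldNormedType.Exports.

Local Open Scope classical_set_scope.
Local Open Scope ring_scope.

(** * The transfer operator *)

Section Transfer.
Context {R : realType}.
Implicit Types (v f h : int -> R) (beta theta lambda : R) (x y : int).

Definition transfer v (beta : R) f y : R :=
  expR (beta * v y) * ((f (y + 1) + f (y - 1)) / 2).

Definition partition_function v (beta theta : R) (n : nat) : int -> R :=
  iter n (transfer v beta) (fun y => expR (theta * y%:~R)).

(** The operator is positive and moves by nearest neighbors, so [n] iterations at [x] see only the
    window of radius [n]. Comparison functions need to be controlled only there. *)
Lemma iter_transfer_le v beta n f h x :
    (forall y, `|y - x| <= n%:Z -> f y <= h y) ->
  iter n (transfer v beta) f x <= iter n (transfer v beta) h x.
Proof.
elim: n x => [|n IH] x fh /=; first by apply: fh; rewrite subrr normr0.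
rewrite /transfer ler_wpM2l ?expR_ge0// ler_pM2r ?invr_gt0//.
by apply: lerD; apply: IH => y yx; apply: fh; lia.
Qed.

Lemma iter_transfer_lin v beta n (a b : R) f h x :
  iter n (transfer v beta) (fun y => a * f y + b * h y) x =
  a * iter n (transfer v beta) f x + b * iter n (transfer v beta) h x.
Proof.
by elim: n x => // n IH x /=; rewrite /transfer !IH; ring.
Qed.

Lemma iter_transfer_eigen v beta lambda n h x :
    (forall y, transfer v beta h y = expR lambda * h y) ->
  iter n (transfer v beta) h x = expR (lambda * n%:R) * h x.
Proof.
move=> hh; elim: n x => [|n IH] x /=; first by rewrite mulr0 expR0 mul1r.
rewrite /transfer !IH -mulrDr -mulrA mulrCA -/(transfer v beta h x) hh.
rewrite mulrA -expRD; congr (expR _ * _).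
by rewrite -[n.+1]addn1 natrD mulrDr mulr1 addrC.
Qed.

(** Each step contributes a factor at most [exp beta]. This makes the constant terms in both
    eigenfunction comparisons negligible, since [beta < lambda]. *)
Lemma iter_transfer1_le v beta n x :
    0 <= beta -> (forall y, v y <= 1) ->
  iter n (transfer v beta) (fun=> 1) x <= expR (beta * n%:R).
Proof.
move=> b0 v1; elim: n x => [|n IH] x /=; first by rewrite mulr0 expR0.
rewrite /transfer -(natr1 n) mulrDr mulr1 expRD mulrC.
have H1 := IH (x + 1); have H2 := IH (x - 1).
apply: ler_pM; rewrite ?expR_ge0//.
- have H (y : int) : 0 <= iter n (transfer v beta) (fun=> 1) y.
    by elim: n {IH H1 H2} y => //= n IH y; rewrite mulr_ge0 ?expR_ge0// divr_ge0// addr_ge0.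
  by rewrite divr_ge0// addr_ge0.
- lra.
- by rewrite ler_expR; have := v1 x; nra.
Qed.

Lemma partition_function_gt0 v beta theta n x :
  0 < partition_function v beta theta n x.
Proof.
rewrite /partition_function; elim: n x => [|n IH] x /=; first exact: expR_gt0.
by rewrite /transfer mulr_gt0 ?expR_gt0// divr_gt0// addr_gt0.
Qed.

(** Simple random walk is symmetric. This identity reduces negative tilts to positive ones in the
    reversed environment. *)
Lemma partition_function_reflect v beta theta n x :
  partition_function (fun y => v (- y)) beta (- theta) n (- x) =
  partition_function v beta theta n x.
Proof.
rewrite /partition_function; elim: n x => [|n IH] x /=.
  by rewrite mulrNz mulrNN.
rewrite /transfer opprK.
have -> : - x + 1 = - (x - 1) by rewrite opprB addrC.
have -> : - x - 1 = - (x + 1) by rewrite opprD.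
by rewrite !IH (addrC (iter _ _ _ (x - 1))).
Qed.

(** Uniformity over [|x| <= C * n] is what the scaling limit requires: there the starting point and
    the time grow at comparable speed. *)
Definition rate_ge v (beta theta lambda : R) :=
  forall C eps : R, 0 < C -> 0 < eps -> exists N : nat, forall n x,
    (N <= n)%N -> `|x|%:~R <= C * n%:R ->
    (lambda - eps) * n%:R + theta * x%:~R
      <= ln (partition_function v beta theta n x).

Definition rate_le v (beta theta lambda : R) :=
  forall C eps : R, 0 < C -> 0 < eps -> exists N : nat, forall n x,
    (N <= n)%N -> `|x|%:~R <= C * n%:R ->
    ln (partition_function v beta theta n x)
      <= (lambda + eps) * n%:R + theta * x%:~R.

Lemma rate_ge_reflect v beta theta lambda :
  rate_ge (fun y => v (- y)) beta (- theta) lambda -> rate_ge v beta theta lambda.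
Proof.
move=> H C eps C0 e0; have [N HN] := H _ _ C0 e0; exists N => n x Nn xC.
have := HN n (- x) Nn; rewrite normrN partition_function_reflect mulrNz mulrNN.
exact.
Qed.

Lemma rate_le_reflect v beta theta lambda :
  rate_le (fun y => v (- y)) beta (- theta) lambda -> rate_le v beta theta lambda.
Proof.
move=> H C eps C0 e0; have [N HN] := H _ _ C0 e0; exists N => n x Nn xC.
have := HN n (- x) Nn; rewrite normrN partition_function_reflect mulrNz mulrNN.
exact.
Qed.

(** This says [F y = m * y + o(|y|)] in both directions; the additive constant [K] takes care of the
    small [y]. *)
Definition asymp_linear (F : int -> R) (m : R) :=
  forall eps : R, 0 < eps -> exists K : R, forall y,
    `|F y - m * y%:~R| <= eps * `|y|%:~R + K.

Lemma asymp_linear_increment F (m C eps : R) :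
    asymp_linear F m -> 0 < C -> 0 < eps -> exists N : nat, forall n x y,
    (N <= n)%N -> `|x|%:~R <= C * n%:R -> `|y - x| <= n%:Z ->
  `|F y - F x - m * (y - x)%:~R| <= eps * n%:R.
Proof.
move=> Fm C0 e0.
(* As [|x| <= C * n] and [|y| <= (C + 1) * n], this slope makes the two linear errors add up to
   [eps * n / 2]; the other half absorbs the constant [K] twice. *)
have d0 : 0 < eps / (2 * (2 * C + 1)) by apply: divr_gt0 => //; lra.
have [K HK] := Fm _ d0.
exists (Num.truncn (4 * `|K| / eps)).+1 => n x y Nn xC yx.
have Kn : 4 * `|K| <= eps * n%:R.
  rewrite [leRHS]mulrC -ler_pdivrMr//; apply: le_trans (ltW (truncnS_gt _)) _.
  by rewrite ler_nat.
have yC : `|y|%:~R <= (C + 1) * n%:R :> R.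
  have : `|y|%:~R <= `|x|%:~R + n%:R :> R.
    by rewrite [n%:R]pmulrn -intrD ler_int; lia.
  by lra.
have := HK x; have := HK y; have := ler_norm K.
set d := eps / _ in d0 HK *.
have dE : d * (2 * C + 1) * n%:R = eps * n%:R / 2.
  rewrite /d; field; lra.
have dx : d * `|x|%:~R <= d * (C * n%:R) by rewrite ler_pM2l.
have dy : d * `|y|%:~R <= d * ((C + 1) * n%:R) by rewrite ler_pM2l.
rewrite intrB !ler_norml => HK1 /andP[H1 H2] /andP[H3 H4].
apply/andP; split; lra.
Qed.

(** * Comparison of the tilted initial condition with a positive eigenfunction *)

Section Eigenfunction.
Variables (v : int -> R) (beta theta lambda alpha : R) (h : int -> R).
Hypotheses (beta0 : 0 <= beta) (v1 : forall y, v y <= 1).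
Hypotheses (blambda : beta < lambda) (h0 : forall y, 0 < h y).
Hypotheses (h_mono : forall y, h y <= h (y + 1)).
Hypothesis h_eigen : forall y, transfer v beta h y = expR lambda * h y.
Hypothesis h_growth : asymp_linear (fun y => ln (h y)) alpha.

Let h_le y z : y <= z -> h y <= h z.
Proof.
move=> yz; have -> : z = y + `|z - y|%N%:Z by lia.
elim: `|z - y|%N => [|n IH]; first by rewrite addr0.
by rewrite -addn1 PoszD addrA; apply: le_trans IH _; apply: h_mono.
Qed.

Let ratioE x y : h y / h x = expR (ln (h y) - ln (h x)).
Proof. by rewrite expRB !lnK ?posrE. Qed.

(** To the right of [x] the faster growth of [h] dominates [exp (theta * y)], up to a factor
    [exp (eps / 2 * n)]; to the left, [exp (theta * y) <= exp (theta * x)] and the constant term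
    suffices. *)
Lemma eigenfunction_rate_le : 0 <= theta -> theta < alpha -> rate_le v beta theta lambda.
Proof.
move=> theta0 ta C eps C0 e0.
have e20 : 0 < eps / 2 by lra.
have [N1 HN] := asymp_linear_increment h_growth C0 e20.
(* With [eps * n >= 4], the spare factor [exp (eps / 2 * n)] is at least 2 and absorbs the sum of
   the two terms. *)
exists (maxn N1 (Num.truncn (4 / eps)).+1) => n x; rewrite geq_max => /andP[Nn N2] xC.
have en : 4 <= eps * n%:R.
  rewrite mulrC -ler_pdivrMr//; apply: le_trans (ltW (truncnS_gt _)) _.
  by rewrite ler_nat.
have n0 : 0 <= n%:R :> R by [].
rewrite -ler_expR lnK ?posrE ?partition_function_gt0//.
apply: (@le_trans _ _ (iter n (transfer v beta)
  (fun y => (expR (theta * x%:~R + eps / 2 * n%:R) / h x) * h y + expR (theta * x%:~R) * 1) x)).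
  apply: iter_transfer_le => y yx.
  have [xy|xy] := leP x y; last first.
    rewrite mulr1 -[X in X <= _]add0r lerD//.
      by rewrite mulr_ge0 ?divr_ge0 ?expR_ge0 ?(ltW (h0 _)).
    by rewrite ler_expR ler_wpM2l// ler_int ltW.
  rewrite -[X in X <= _]addr0 lerD ?mulr_ge0 ?expR_ge0//.
  rewrite -mulrA (mulrC _ (h y)) ratioE -expRD ler_expR.
  have := HN n x y Nn xC yx; rewrite /= ler_norml => /andP[H1 H2].
  have : 0 <= (y - x)%:~R * (alpha - theta).
    by apply: mulr_ge0; [rewrite ler0z subr_ge0 | rewrite subr_ge0 ?ltW].
  by rewrite intrB in H1 H2 *; lra.
rewrite iter_transfer_lin (iter_transfer_eigen _ _ h_eigen).
rewrite mulrCA divfK ?gt_eqF// -expRD.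
apply: (@le_trans _ _ (expR (lambda * n%:R + (theta * x%:~R + eps / 2 * n%:R)) +
  expR (theta * x%:~R) * expR (beta * n%:R))).
  by rewrite lerD2l ler_wpM2l ?expR_ge0// iter_transfer1_le.
have -> : (lambda + eps) * n%:R + theta * x%:~R =
    eps / 2 * n%:R + (lambda * n%:R + (theta * x%:~R + eps / 2 * n%:R)) by lra.
rewrite (expRD (eps / 2 * n%:R)) -expRD.
set a := expR (lambda * _ + _).
have : expR (theta * x%:~R + beta * n%:R) <= a.
  rewrite ler_expR.
  have : 0 <= (lambda - beta) * n%:R by rewrite mulr_ge0// subr_ge0 ltW.
  lra.
have a0 : 0 < a by exact: expR_gt0.
have := expR_ge1Dx (eps / 2 * n%:R); set b := expR (eps / 2 * _) => ? ?.
have : 0 <= (b - 2) * a by rewrite mulr_ge0 ?(ltW a0)//; lra.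
lra.
Qed.

(** Since [h] is nondecreasing, [h y / h x - 1] is nonpositive to the left of [x], where nothing
    else bounds [h] by the exponential; to the right, [h] grows no faster than the tilt. *)
Lemma eigenfunction_rate_ge : alpha <= theta -> rate_ge v beta theta lambda.
Proof.
move=> ta C eps C0 e0.
have e20 : 0 < eps / 2 by lra.
have [N1 HN] := asymp_linear_increment h_growth C0 e20.
(* For such [n], [exp (lambda * n)] is at least twice [exp (beta * n)] and at least twice
   [exp (lambda * n - eps / 2 * n)], which leaves room for the subtracted term. *)
exists (maxn N1 (Num.truncn (2 / eps + (lambda - beta)^-1)).+1) => n x.
rewrite geq_max => /andP[Nn N2] xC.
have n0 : 0 <= n%:R :> R by [].
have nge : 2 / eps + (lambda - beta)^-1 <= n%:R.
  by apply: le_trans (ltW (truncnS_gt _)) _; rewrite ler_nat.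
have i1 : 0 < 2 / eps by rewrite divr_gt0.
have i2 : 0 < (lambda - beta)^-1 by rewrite invr_gt0 subr_gt0.
have en : 2 <= eps * n%:R.
  by rewrite mulrC -ler_pdivrMr//; lra.
have ln1 : 1 <= (lambda - beta) * n%:R.
  by rewrite mulrC -ler_pdivrMr ?subr_gt0// mul1r; lra.
rewrite -ler_expR lnK ?posrE ?partition_function_gt0//.
set c := expR (theta * x%:~R - eps / 2 * n%:R).
have c0 : 0 < c by exact: expR_gt0.
apply: (@le_trans _ _ (iter n (transfer v beta)
  (fun y => (c / h x) * h y + (- c) * 1) x)); last first.
  apply: iter_transfer_le => y yx.
  rewrite mulr1 -mulrA (mulrC _ (h y)).
  have [xy|xy] := leP x y; last first.
    apply: (@le_trans _ _ 0); last exact: expR_ge0.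
    rewrite subr_le0 ger_pMr// ler_pdivrMr// mul1r; exact: h_le (ltW xy).
  apply: (@le_trans _ _ (c * (h y / h x))); first by rewrite gerDl; lra.
  rewrite ratioE -expRD ler_expR.
  have := HN n x y Nn xC yx; rewrite /= ler_norml => /andP[H1 H2].
  have : 0 <= (y - x)%:~R * (theta - alpha).
    by apply: mulr_ge0; [rewrite ler0z subr_ge0 | rewrite subr_ge0].
  by rewrite intrB in H1 H2 *; lra.
rewrite iter_transfer_lin (iter_transfer_eigen _ _ h_eigen).
rewrite mulrCA divfK ?gt_eqF// mulNr.
apply: (@le_trans _ _ (expR (lambda * n%:R) * c - c * expR (beta * n%:R))); last first.
  by rewrite lerD2l lerN2 ler_wpM2l ?(ltW c0)// iter_transfer1_le.
have -> : (lambda - eps) * n%:R + theta * x%:~R =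
    (theta * x%:~R - eps / 2 * n%:R) + (lambda * n%:R - eps / 2 * n%:R) by lra.
rewrite (expRD (theta * x%:~R - eps / 2 * n%:R)) -/c; clearbody c.
rewrite (mulrC _ c) -mulrBr ler_pM2l//.
have -> : expR (lambda * n%:R) =
    expR (lambda * n%:R - eps / 2 * n%:R) * expR (eps / 2 * n%:R).
  by rewrite -expRD subrK.
have b1 : 2 <= expR (eps / 2 * n%:R) by have := expR_ge1Dx (eps / 2 * n%:R); lra.
have l1 : expR (beta * n%:R) * 2 <= expR (lambda * n%:R - eps / 2 * n%:R) * expR (eps / 2 * n%:R).
  rewrite -expRD subrK (_ : lambda * _ = beta * n%:R + (lambda - beta) * n%:R); last by lra.
  rewrite expRD ler_pM2l ?expR_gt0//.
  have := expR_ge1Dx ((lambda - beta) * n%:R); lra.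
have : 0 <= expR (lambda * n%:R - eps / 2 * n%:R) by exact: expR_ge0.
nra.
Qed.

End Eigenfunction.
End Transfer.

(** * The pointwise ergodic theorem *)

Section Ergodic.
Context {d : measure_display} {Omega : measurableType d} {R : realType}.
Variable P : probability Omega R.
Implicit Types (T Tinv : Omega -> Omega) (f : Omega -> R).

Definition birkhoff_sum T f (n : nat) (omega : Omega) : R :=
  \sum_(k < n) f (iter k T omega).

Lemma bounded_integrable f (B : R) :
  measurable_fun setT f -> (forall omega, `|f omega| <= B) ->
  P.-integrable setT (EFin \o f).
Proof.
move=> mf fB; apply: measurable_bounded_integrable => //.
  by rewrite -ge0_fin_numE// fin_num_measure.
exists B; split; first exact: num_real.
by move=> x Bx omega _ /=; apply: le_trans (fB _) (ltW Bx).
Qed.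

Lemma Rintegral_preserving T f (B : R) :
    measure_preserving P T -> measurable_fun setT f ->
    (forall omega, `|f omega| <= B) ->
  \int[P]_omega f (T omega) = \int[P]_omega f omega.
Proof.
move=> [mT PT] mf fB; rewrite /Rintegral; congr fine.
have mEf : measurable_fun setT (EFin \o f) by exact/measurable_EFinP.
have := integral_pushforward mT (mu := P) (D := setT) mEf.
rewrite preimage_setT => <- //; last first.
  apply: (@bounded_integrable (f \o T) B) => //.
    exact: measurableT_comp.
  by move=> omega; exact: fB.
by apply: (eq_measure_integral P) => A mA _; exact: PT.
Qed.

(* The running maximum [max(0, S_1, ..., S_n)] of the Birkhoff sums. *)
Fixpoint birkhoff_max T f (n : nat) (omega : Omega) : R :=
  if n is m.+1 then Num.max 0 (f omega + birkhoff_max T f m (T omega)) else 0.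

Lemma birkhoff_max_ge0 T f n omega : 0 <= birkhoff_max T f n omega.
Proof. by case: n => //= n; rewrite le_max lexx. Qed.

Lemma birkhoff_maxS T f n omega :
  birkhoff_max T f n omega <= birkhoff_max T f n.+1 omega.
Proof.
elim: n omega => [|n IH] omega; first exact: birkhoff_max_ge0.
by rewrite [X in X <= _]/= [X in _ <= X]/= ge_max !le_max lexx/= lerD2l IH orbT.
Qed.

Lemma birkhoff_max_homo T f omega :
  {homo (birkhoff_max T f)^~ omega : m n / (m <= n)%N >-> m <= n}.
Proof.
by apply: homo_leq => //; [exact: le_trans | move=> n; exact: birkhoff_maxS].
Qed.

Lemma birkhoff_sum_le_max T f n omega :
  birkhoff_sum T f n omega <= birkhoff_max T f n omega.
Proof.
rewrite /birkhoff_sum; elim: n omega => [|n IH] omega; first by rewrite big_ord0.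
rewrite big_ord_recl /= le_max lerD2l; apply/orP; right.
apply: le_trans (IH _); rewrite le_eqVlt; apply/orP; left; apply/eqP.
by apply: eq_bigr => i _; rewrite /bump /= -iterSr.
Qed.

Lemma birkhoff_max_bound T f B n omega : (forall omega, `|f omega| <= B) ->
  birkhoff_max T f n omega <= B * n%:R.
Proof.
move=> fB; have B0 : 0 <= B := le_trans (normr_ge0 _) (fB omega).
elim: n omega => [|n IH] omega; first by rewrite mulr0.
rewrite [X in X <= _]/= ge_max mulr_ge0//= -natr1 mulrDr mulr1 addrC lerD//.
by apply: le_trans (fB omega); exact: ler_norm.
Qed.

Lemma measurable_birkhoff_max T f n : measurable_fun setT T ->
  measurable_fun setT f -> measurable_fun setT (birkhoff_max T f n).
Proof.
move=> mT mf; elim: n => [|n IH] /=; first exact: measurable_cst.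
apply: measurable_maxr; first exact: measurable_cst.
by apply: measurable_funD => //; exact: measurableT_comp.
Qed.

(* The increments [M_{n+1} - M_n o T = max(f, - M_n o T)] have nonnegative
   integral and tend to [f] wherever [M_n] is unbounded. *)
Lemma birkhoff_sum_bounded T f (B : R) :
    measure_preserving P T -> ergodic P T -> measurable_fun setT f ->
    (forall omega, `|f omega| <= B) -> \int[P]_omega f omega < 0 ->
  {ae P, forall omega, exists K : R, forall n, birkhoff_sum T f n omega <= K}.
Proof.
move=> mpT eT mf fB f_lt0; have [mT PT] := mpT.
pose M := birkhoff_max T f.
have mM n : measurable_fun setT (M n) by exact: measurable_birkhoff_max.
(* [D] is the set where the running maxima are unbounded. It is invariant because [M] at time [n.+1]
   is [max 0 (f + M n o T)], so ergodicity leaves only measure 0, which is the claim, or measure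
   1. *)
pose D := \bigcap_k \bigcup_n [set omega | k%:R < M n omega].
have mD : measurable D.
  apply: bigcap_measurable => // k _; apply: bigcup_measurable => n _.
  rewrite -[X in measurable X]setTI.
  have -> : [set omega | k%:R < M n omega] = M n @^-1` `]k%:R, +oo[%classic.
    by apply/seteqP; split => omega /=; rewrite in_itv/= andbT.
  by apply: (mM n measurableT); exact: measurable_itv.
have DE omega : D omega <-> forall K : R, exists n, K < M n omega.
  split=> [Do K|H k _]; last by have [n] := H k%:R; exists n.
  have [n _ /= kn] := Do (Num.truncn K).+1 I.
  by exists n; apply: lt_trans kn; exact: truncnS_gt.
have DT : T @^-1` D = D.
  apply/seteqP; split => omega; rewrite /preimage/= => /DE H; apply/DE => K.
    have [n Kn] := H (K - f omega); exists n.+1.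
    by rewrite /M /= lt_max; apply/orP; right; rewrite -ltrBlDl.
  have [[|n]] := H (Num.max 0 (K + f omega)); rewrite /M /=.
    by rewrite ltNge le_max lexx.
  rewrite lt_max => /orP[]; first by rewrite ltNge le_max lexx.
  by rewrite gt_max => /andP[_]; rewrite addrC ltrD2l => ?; exists n.
have ND omega : ~ D omega -> exists K : R, forall n, birkhoff_sum T f n omega <= K.
  move=> nD; have : ~ forall K : R, exists n, K < M n omega by move=> H; apply/nD/DE.
  move/existsNP => [K HK]; exists K => n.
  apply: le_trans (birkhoff_sum_le_max _ _ _ _) _.
  by rewrite leNgt; apply/negP => Kn; apply: HK; exists n.
have [D0|D1] := eT D mD DT.
  exists D; split => //= omega nH.
  by apply: contrapT => /ND.
exfalso; suff : 0 <= \int[P]_omega f omega by rewrite leNgt f_lt0.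
pose r n omega := M n.+1 omega - M n (T omega).
have mr n : measurable_fun setT (r n).
  by apply: measurable_funB => //; apply: measurableT_comp.
have rE n omega : r n omega = Num.max (- M n (T omega)) (f omega).
  by rewrite /r /M /= addr_maxl add0r addrK.
have MB n omega : `|M n omega| <= B * n%:R.
  by rewrite ger0_norm ?birkhoff_max_ge0//; exact: birkhoff_max_bound.
have rB n omega : `|r n omega| <= B.
  rewrite rE ler_norml; have := fB omega; rewrite ler_norml => /andP[H1 H2].
  rewrite le_max H1 orbT ge_max H2 andbT /=.
  have := birkhoff_max_ge0 T f n (T omega); rewrite -/(M n _).
  have := le_trans (normr_ge0 _) (fB omega); lra.
have r0 n : 0 <= \int[P]_omega r n omega.
  rewrite /r RintegralB//; last 2 first.
  - exact: bounded_integrable (mM _) (MB _).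
  - apply: (@bounded_integrable (M n \o T) (B * n%:R)) => //.
      exact: measurableT_comp.
    by move=> omega; exact: MB.
  rewrite (Rintegral_preserving mpT (mM n) (MB n)) subr_ge0.
  apply: le_Rintegral => //.
  - exact: bounded_integrable (mM _) (MB _).
  - exact: bounded_integrable (mM _) (MB _).
  - by move=> omega _; exact: birkhoff_maxS.
have iB : P.-integrable setT (EFin \o cst B).
  apply: (@bounded_integrable _ `|B|) => //; exact: measurable_cst.
have [] := @dominated_convergence _ _ _ P setT measurableT
  (fun n => EFin \o r n) (EFin \o f) (EFin \o cst B).
- by move=> n; exact/measurable_EFinP.
- exact/measurable_EFinP.
- exists (~` D); split; first exact: measurableC.
    by apply: etrans (probability_setC P mD) _; rewrite D1 subee.
  move=> omega /= H Do; apply: H => _.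
  (* On [D] the convergence is an eventual equality: once [M m (T omega) >= - f omega], the
     increment [r m omega] is exactly [f omega]. *)
  apply: cvg_near_cst.
  have /DE/(_ (- f omega)) [n fn] : D (T omega) by rewrite -DT in Do.
  near=> m; rewrite /= rE; congr EFin; apply/max_idPr.
  rewrite lerNl; apply: le_trans (ltW fn) _.
  by apply: birkhoff_max_homo; near: m; exact: nbhs_infty_ge.
- exact: iB.
- by apply: aeW => omega n _; rewrite /= lee_fin.
move=> _ _ rf.
rewrite /Rintegral fine_ge0//.
rewrite -(cvg_lim _ rf)//; apply: lime_ge; first by apply/cvg_ex; eexists; exact: rf.
apply: nearW => n; have := r0 n; rewrite /Rintegral => h.
rewrite -[leRHS]fineK ?lee_fin//.
apply: integrable_fin_num => //; exact: bounded_integrable (mr n) (rB n).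
Unshelve. all: by end_near. Qed.

End Ergodic.

(** * Walks confined to a hill *)

Section Hills.
Context {R : realType}.
Implicit Types (v f h : int -> R) (beta theta lambda : R) (x y z : int).

Lemma iter_transfer_subeigen v beta lambda n h x :
    (forall y, expR lambda * h y <= transfer v beta h y) ->
  expR (lambda * n%:R) * h x <= iter n (transfer v beta) h x.
Proof.
move=> hh; elim: n x => [|n IH] x /=; first by rewrite mulr0 expR0 mul1r.
have -> : lambda * n.+1%:R = lambda * n%:R + lambda by rewrite -natr1; ring.
rewrite expRD -mulrA; apply: le_trans (ler_wpM2l (expR_ge0 _) (hh x)) _.
rewrite /transfer mulrCA ler_wpM2l ?expR_ge0//.
by rewrite mulrA ler_pM2r ?invr_gt0// mulrDr lerD.
Qed.

Lemma iter_transfer_ge0 v beta n f x :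
  (forall y, 0 <= f y) -> 0 <= iter n (transfer v beta) f x.
Proof.
move=> f0; elim: n x => //= n IH x.
by rewrite /transfer mulr_ge0 ?expR_ge0// divr_ge0// addr_ge0.
Qed.

(** The probability [1 / 2] of the step is bounded below by [exp (- 1)], so that the costs of
    successive steps add up in the exponent. *)
Lemma transfer_step v beta f x z :
    0 <= beta -> (forall y, 0 <= v y) -> (forall y, 0 <= f y) ->
    `|z - x| = 1 -> expR (- 1) * f z <= transfer v beta f x.
Proof.
move=> b0 v0 f0 zx.
have zfx : f z <= f (x + 1) + f (x - 1).
  have [->|->] : z = x + 1 \/ z = x - 1 by lia.
    by rewrite lerDl.
  by rewrite lerDr.
have e2 : expR (- 1) <= 2^-1 :> R.
  by rewrite expRN lef_pV2 ?posrE ?expR_gt0//; have := expR_ge1Dx (1 : R); lra.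
have ev : 1 <= expR (beta * v x) by rewrite -expR0 ler_expR mulr_ge0.
apply: (@le_trans _ _ ((f (x + 1) + f (x - 1)) / 2)).
  by rewrite mulrC; apply: ler_pM => //; exact: expR_ge0.
by rewrite /transfer ler_peMl// divr_ge0// addr_ge0.
Qed.

(** Keep only the walks whose first [m] steps go straight from [x] to [z]. *)
Lemma iter_transfer_travel v beta m n f x z :
    0 <= beta -> (forall y, 0 <= v y) -> (forall y, 0 <= f y) ->
    `|z - x| = m%:Z ->
  expR (- m%:R) * iter n (transfer v beta) f z
    <= iter (m + n) (transfer v beta) f x.
Proof.
move=> b0 v0 f0; elim: m x => [|m IH] x zx.
  by rewrite oppr0 expR0 mul1r (_ : x = z)//; lia.
have [x' [x'x zx']] : exists x', `|x' - x| = 1 /\ `|z - x'| = m%:Z.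
  have [xz|xz] := leP x z; first by exists (x + 1); lia.
  by exists (x - 1); lia.
rewrite -natr1 opprD addrC expRD -mulrA addSn.
apply: le_trans (ler_wpM2l (expR_ge0 _) (IH _ zx')) _.
by apply: transfer_step => // y; exact: iter_transfer_ge0.
Qed.

(* On the hill [z, z + l], [p j = (j + 1) (l + 1 - j)] is concave with second
   difference [-2], vanishes just outside, and is at least [l + 1]: the average
   of its neighbors is [p j - 1 >= l / (l + 1) * p j]. *)
Lemma partition_function_hill v beta theta c (l n : nat) z :
    0 <= beta -> (0 < l)%N -> (forall j : nat, (j <= l)%N -> c <= v (z + j%:Z)) ->
  expR (theta * z%:~R - (`|theta| + 2) * l%:R + (beta * c - l%:R^-1) * n%:R)
    <= partition_function v beta theta n z.
Proof.
move=> b0 l0 cv.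
have l1 : 1 <= l%:R :> R by rewrite ler1n.
pose p (y : int) : R := ((y - z)%:~R + 1) * (l%:R + 1 - (y - z)%:~R).
pose phi y := if (z <= y <= z + l%:Z) then p y else 0.
have range y : z <= y <= z + l%:Z -> 0 <= ((y - z)%:~R : R) <= l%:R.
  by move=> ?; rewrite ler0z [l%:R]pmulrn ler_int; apply/andP; split; lia.
have p_ge y : z <= y <= z + l%:Z -> l%:R + 1 <= p y.
  by move=> yz; have /andP[] := range y yz; rewrite /p; set j := (_ - _)%:~R; nra.
have phi_ge0 y : 0 <= phi y.
  rewrite /phi; case: ifPn => // yz; have := p_ge _ yz; lra.
have phi_lb y : z - 1 <= y <= z + l%:Z + 1 -> p y <= phi y.
  move=> yz; rewrite /phi; case: ifPn => // H; rewrite /p.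
  have [->|->] : y = z - 1 \/ y = z + l%:Z + 1 by lia.
    by rewrite addrAC subrr add0r mulrN1z addNr mul0r.
  rewrite (_ : z + l%:Z + 1 - z = l%:Z + 1); last by ring.
  by rewrite intrD subrr mulr0.
have step y : expR (beta * c - l%:R^-1) * phi y <= transfer v beta phi y.
  have [yz|yz] := boolP (z <= y <= z + l%:Z); last first.
    rewrite {1}/phi (negbTE yz) mulr0.
    by rewrite /transfer mulr_ge0 ?expR_ge0// divr_ge0// addr_ge0.
  have cvy : c <= v y.
    have := cv `|y - z|%N; rewrite (_ : z + _ = y); last by lia.
    by apply; lia.
  rewrite {1}/phi yz expRD -mulrA /transfer ler_pM ?expR_ge0//.
  - by rewrite mulr_ge0 ?expR_ge0//; have := p_ge _ yz; lra.
  - by rewrite ler_expR ler_wpM2l.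
  apply: (@le_trans _ _ ((p (y + 1) + p (y - 1)) / 2)); last first.
    by rewrite ler_pM2r ?invr_gt0// lerD//; apply: phi_lb; lia.
  have -> : (p (y + 1) + p (y - 1)) / 2 = p y - 1.
    rewrite /p (_ : y + 1 - z = (y - z) + 1); last by ring.
    rewrite (_ : y - 1 - z = (y - z) - 1); last by ring.
    by rewrite intrD intrB; field.
  (* This is [exp (- 1 / l) <= l / (l + 1)], which turns the loss on the hill into the rate
     [1 / l]. *)
  have e1 : expR (- l%:R^-1) * (l%:R + 1) <= l%:R :> R.
    rewrite expRN mulrC ler_pdivrMr ?expR_gt0//.
    have := expR_ge1Dx (l%:R^-1 : R) => H.
    have : l%:R * (1 + l%:R^-1) <= l%:R * expR (l%:R^-1 : R) by rewrite ler_pM2l//; lra.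
    by rewrite mulrDr mulfV ?mulr1// gt_eqF//; lra.
  have := p_ge _ yz; have := expR_ge0 (- l%:R^-1 : R).
  set e := expR _ in e1 *; set q := p y; move=> e0 ql.
  have : e * (l%:R + 1) * q <= l%:R * q by rewrite ler_wpM2r//; lra.
  nra.
(* On the hill, [p <= (l + 1)^2 <= exp (2 * l)] and [theta * y >= theta * z - |theta| * l]; hence
   [exp K * phi] lies below the initial condition. *)
set K := theta * z%:~R - (`|theta| + 2) * l%:R.
apply: (@le_trans _ _ (iter n (transfer v beta)
  (fun y => expR K * phi y + 0 * phi y) z)); last first.
  apply: iter_transfer_le => y _; rewrite mul0r addr0.
  rewrite /phi; case: ifPn => [/(range y) yz|_]; last by rewrite mulr0 expR_ge0.
  apply: (@le_trans _ _ (expR K * expR (2 * l%:R))).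
    rewrite ler_pM2l ?expR_gt0// /p.
    move: yz; case/andP; set j := (y - z)%:~R => j0 jl.
    have : 1 + l%:R <= expR l%:R :> R := expR_ge1Dx _.
    rewrite (_ : 2 * l%:R = l%:R + l%:R)// 1?expRD; last by ring.
    set E := expR _; move=> lE.
    by apply: ler_pM; lra.
  rewrite -expRD ler_expR /K.
  have -> : theta * y%:~R = theta * z%:~R + theta * (y - z)%:~R by rewrite intrB; ring.
  move: yz; case/andP; set j := (y - z)%:~R => j0 jl.
  have := ler_norm (- theta); rewrite normrN => tn.
  have t0 := normr_ge0 theta.
  have : - theta * j <= `|theta| * j by rewrite ler_wpM2r.
  have : `|theta| * j <= `|theta| * l%:R by rewrite ler_wpM2l.
  lra.
rewrite iter_transfer_lin mul0r addr0 expRD ler_pM2l ?expR_gt0//.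
apply: le_trans (iter_transfer_subeigen n z step).
rewrite ler_peMr ?expR_ge0//.
have zz : z <= z <= z + l%:Z by lia.
by rewrite /phi zz; have := p_ge _ zz; lra.
Qed.

(** Hills of any height below 1 and any length occur within [o(n)] of every point at distance
    [O(n)], so that reaching one costs only [exp (- o(n))]. *)
Definition has_hills v := forall (c : R) (l : nat), 0 < c < 1 -> (0 < l)%N ->
  forall C eps : R, 0 < C -> 0 < eps -> exists N : nat, forall n x,
    (N <= n)%N -> `|x|%:~R <= C * n%:R -> exists2 z,
    `|z - x|%:~R <= eps * n%:R & forall j : nat, (j <= l)%N -> c <= v (z + j%:Z).

(** The walk goes straight to a hill and stays on it. The loss [eps * n] is split into four
    quarters: the height of the hill, its finite length, the travel, and the constant [K]. *)
Lemma hills_rate_ge v beta theta : 0 < beta -> (forall y, 0 <= v y) ->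
  has_hills v -> rate_ge v beta theta beta.
Proof.
move=> b0 v0 hills C eps C0 e0.
pose l := (Num.truncn (4 / eps)).+1.
have l0 : 0 < l%:R :> R by rewrite ltr0n.
have le : l%:R^-1 <= eps / 4.
  rewrite -[eps / 4]invrK lef_pV2 ?posrE ?invr_gt0//; last lra.
  rewrite invf_div; exact: ltW (truncnS_gt _).
pose c := 1 - Num.min (1 / 2) (eps / 4 / beta).
have [c01 ce] : 0 < c < 1 /\ beta - eps / 4 <= beta * c <= beta.
  have q0 : 0 < eps / 4 / beta by rewrite !divr_gt0.
  have m0 : 0 < Num.min (1 / 2) (eps / 4 / beta) by rewrite lt_min q0 andbT; lra.
  have m1 : Num.min (1 / 2) (eps / 4 / beta) <= 1 / 2 by rewrite ge_min lexx.
  have m2 : beta * Num.min (1 / 2) (eps / 4 / beta) <= eps / 4.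
    by rewrite mulrC -ler_pdivlMr// ge_min lexx orbT.
  have m3 : 0 <= beta * Num.min (1 / 2) (eps / 4 / beta) by rewrite mulr_ge0 ?ltW.
  move: m0 m1 m2 m3; rewrite /c; set m := Num.min _ _ => *.
  by split; apply/andP; split; lra.
have t0 := normr_ge0 theta.
(* Each of the at most [delta * n] travel steps costs at most 1 for its probability, [|theta|] for
   the displacement and [beta] for the lost reward. The bound by 1 leaves the walk time to
   arrive. *)
pose delta := Num.min 1 (eps / 4 / (1 + `|theta| + beta)).
have s0 : 0 < 1 + `|theta| + beta by lra.
have d0 : 0 < delta by rewrite lt_min ltr01 !divr_gt0.
have d1 : delta <= 1 by rewrite ge_min lexx.
have de : delta * (1 + `|theta| + beta) <= eps / 4.
  by rewrite -ler_pdivlMr// ge_min lexx orbT.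
have [N HN] := hills _ _ c01 (ltn0Sn _ : (0 < l)%N) _ _ C0 d0.
pose K := (`|theta| + 2) * l%:R.
exists (maxn N (Num.truncn (4 * K / eps)).+1) => n x.
rewrite geq_max => /andP[Nn N2] xC.
have n0 : 0 <= n%:R :> R by [].
have Kn : 4 * K <= eps * n%:R.
  rewrite [leRHS]mulrC -ler_pdivrMr//; apply: le_trans (ltW (truncnS_gt _)) _.
  by rewrite ler_nat.
have [z zx hz] := HN n x Nn xC.
pose m := `|z - x|%N.
have mE : `|z - x| = m%:Z by rewrite /m abszE.
have md : m%:R <= delta * n%:R :> R by move: zx; rewrite mE.
have mn : (m <= n)%N.
  by rewrite -(ler_nat R); apply: le_trans md _; rewrite ler_piMl.
rewrite -ler_expR lnK ?posrE ?partition_function_gt0//.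
have := iter_transfer_travel (n - m) (ltW b0) v0
  (fun y => expR_ge0 (theta * y%:~R)) mE.
rewrite subnKC//; apply: le_trans.
apply: le_trans (ler_wpM2l (expR_ge0 _) (partition_function_hill theta _ (ltW b0) _ hz)) => //.
rewrite -expRD ler_expR natrB//.
have m0 : 0 <= m%:R :> R by [].
have tzx : theta * (x%:~R - z%:~R) <= `|theta| * m%:R.
  have -> : `|theta| * m%:R = `|theta * (z - x)%:~R|.
    by rewrite normrM -intr_norm mE.
  by rewrite intrB -[leLHS]opprK -mulrN opprB -normrN ler_norm.
have dn : m%:R * (1 + `|theta| + beta) <= eps / 4 * n%:R.
  apply: (@le_trans _ _ (delta * n%:R * (1 + `|theta| + beta))).
    by rewrite ler_wpM2r// ltW.
  by rewrite mulrAC ler_wpM2r.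
rewrite -/K.
have r1 : (beta - eps / 2) * n%:R <= (beta * c - l%:R^-1) * n%:R.
  by rewrite ler_wpM2r//; lra.
have li0 : 0 < l%:R^-1 :> R by rewrite invr_gt0.
have r2 : (beta * c - l%:R^-1) * m%:R <= beta * m%:R.
  by rewrite ler_wpM2r//; lra.
rewrite mulrBr; lra.
Qed.

End Hills.

(** * Cocycles along the orbit *)

Section Cocycle.
Context {d : measure_display} {Omega : measurableType d} {R : realType}.
Variable P : probability Omega R.
Variables T Tinv : Omega -> Omega.
Hypotheses (TK : cancel T Tinv) (TinvK : cancel Tinv T).
Hypotheses (T_mp : measure_preserving P T) (T_ergodic : ergodic P T).
Hypothesis Tinv_meas : measurable_fun setT Tinv.
Implicit Types (f : Omega -> R) (omega : Omega).

Lemma measure_preserving_inv : measure_preserving P Tinv.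
Proof.
split=> // A mA; have [mT PT] := T_mp.
rewrite -[in RHS](_ : T @^-1` (Tinv @^-1` A) = A).
  by rewrite PT// -[X in measurable X]setTI; exact: Tinv_meas.
by apply/seteqP; split => omega; rewrite /preimage /= TK.
Qed.

Lemma ergodic_inv : ergodic P Tinv.
Proof.
move=> A mA TA; apply: T_ergodic => //.
by rewrite -{1}TA; apply/seteqP; split => omega; rewrite /preimage /= TK.
Qed.

Lemma iterzD1 (y : int) omega :
  iterz T Tinv (y + 1) omega = T (iterz T Tinv y omega).
Proof.
case: y => [n|[|n]]; first by rewrite /= addn1.
  by rewrite /= TinvK.
rewrite (_ : Negz n.+1 + 1 = Negz n) /=; last by lia.
by rewrite TinvK.
Qed.

Lemma iterzB1 (y : int) omega :
  iterz T Tinv (y - 1) omega = Tinv (iterz T Tinv y omega).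
Proof. by rewrite -[in RHS](subrK 1 y) iterzD1 TK. Qed.

Lemma iterz_addn (y : int) (n : nat) omega :
  iterz T Tinv (y + n%:Z) omega = iter n T (iterz T Tinv y omega).
Proof.
elim: n => [|n IH]; first by rewrite addr0.
by rewrite -addn1 PoszD addrA iterzD1 IH addn1.
Qed.

(** The sum of [f] over the sites between 0 and [y], counted negatively for [y < 0]. Composing with
    [Tinv] starts the backward sum at site -1, which makes [cocycleD1] hold on all integers. *)
Definition cocycle f (y : int) omega : R :=
  match y with
  | Posz n => birkhoff_sum T f n omega
  | Negz n => - birkhoff_sum Tinv (f \o Tinv) n.+1 omega
  end.

Lemma cocycleD1 f (y : int) omega :
  cocycle f (y + 1) omega = cocycle f y omega + f (iterz T Tinv y omega).
Proof.
case: y => [n|[|n]].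
- by rewrite /= /birkhoff_sum addn1 big_ord_recr.
- by rewrite /= /birkhoff_sum big_ord0 big_ord_recr big_ord0 /= add0r addNr.
rewrite (_ : Negz n.+1 + 1 = Negz n); last by lia.
by rewrite /= /birkhoff_sum [in RHS]big_ord_recr /= opprD addrNK.
Qed.

Lemma birkhoff_sum_lin S f (a b : R) n omega :
  birkhoff_sum S (fun o => a * f o + b) n omega =
  a * birkhoff_sum S f n omega + b * n%:R.
Proof.
rewrite /birkhoff_sum mulr_sumr big_split /=; congr (_ + _).
by rewrite sumr_const card_ord mulr_natr.
Qed.

Lemma Rintegral_lin f (B a b : R) : measurable_fun setT f ->
    (forall omega, `|f omega| <= B) ->
  \int[P]_omega (a * f omega + b) = a * (\int[P]_omega f omega) + b.
Proof.
move=> mf fB; have if_ := bounded_integrable P mf fB.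
rewrite RintegralD// ?RintegralZl//.
- by rewrite Rintegral_cst// [X in fine X](@probability_setT _ _ _ P)/= mulr1.
- apply: (@bounded_integrable _ _ _ _ _ (`|a| * B)).
    by apply: measurable_funM => //; exact: measurable_cst.
  by move=> omega; rewrite normrM ler_wpM2l.
- apply: (@bounded_integrable _ _ _ _ _ `|b|) => //; exact: measurable_cst.
Qed.

(** The function [f - m - 1 / (k + 1)] has negative integral, so its Birkhoff sums are bounded
    above; countably many [k] cover every [eps]. *)
Lemma birkhoff_sum_upper S f (B : R) : measure_preserving P S -> ergodic P S ->
    measurable_fun setT f -> (forall omega, `|f omega| <= B) ->
  {ae P, forall omega, forall eps : R, 0 < eps -> exists K : R, forall n,
    birkhoff_sum S f n omega - (\int[P]_omega f omega) * n%:R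
      <= eps * n%:R + K}.
Proof.
move=> mpS eS mf fB; set m := Rintegral _ _ _.
have : {ae P, forall omega, forall k : nat, exists K : R, forall n,
    birkhoff_sum S (fun o => 1 * f o + - (m + k.+1%:R^-1)) n omega <= K}.
  apply: ae_foralln => k.
  apply: (@birkhoff_sum_bounded _ _ _ _ _ _ (B + `|m + k.+1%:R^-1|)) => //.
  - apply: measurable_funD; last exact: measurable_cst.
    by apply: measurable_funM => //; exact: measurable_cst.
  - move=> omega; apply: le_trans (ler_normD _ _) _.
    by rewrite mul1r normrN lerD.
  - rewrite (Rintegral_lin _ _ mf fB) mul1r -/m.
    by rewrite opprD addrA subrr sub0r oppr_lt0.
apply: filterS => omega H eps e0.
have [K HK] := H (Num.truncn eps^-1); exists K => n.
have := HK n; rewrite birkhoff_sum_lin mul1r mulNr mulrDl.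
have : (Num.truncn eps^-1).+1%:R^-1 * n%:R <= eps * n%:R.
  rewrite ler_wpM2r// -[leRHS]invrK lef_pV2 ?posrE ?invr_gt0//.
  exact: ltW (truncnS_gt _).
set q := _.+1%:R^-1; lra.
Qed.

(** The lower bound is the upper one for [- f], written [(-1) * f + 0] to fit [birkhoff_sum_lin] and
    [Rintegral_lin]. *)
Lemma birkhoff_sum_linear S f (B : R) : measure_preserving P S -> ergodic P S ->
    measurable_fun setT f -> (forall omega, `|f omega| <= B) ->
  {ae P, forall omega, forall eps : R, 0 < eps -> exists K : R, forall n,
    `|birkhoff_sum S f n omega - (\int[P]_omega f omega) * n%:R|
      <= eps * n%:R + K}.
Proof.
move=> mpS eS mf fB; set m := Rintegral _ _ _.
have H1 := birkhoff_sum_upper mpS eS mf fB.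
have mNf : measurable_fun setT (fun omega => (-1) * f omega + 0).
  apply: measurable_funD; last exact: measurable_cst.
  by apply: measurable_funM => //; exact: measurable_cst.
have NfB omega : `|(-1) * f omega + 0| <= B by rewrite addr0 mulN1r normrN.
have H2 := birkhoff_sum_upper mpS eS mNf NfB.
apply: filterS2 H1 H2 => omega H1 H2 eps e0.
have [K1 HK1] := H1 _ e0; have [K2 HK2] := H2 _ e0.
exists (Num.max K1 K2) => n; rewrite ler_norml; apply/andP; split.
  have := HK2 n; rewrite birkhoff_sum_lin (Rintegral_lin _ _ mf fB) -/m.
  have : K2 <= Num.max K1 K2 by rewrite le_max lexx orbT.
  lra.
have := HK1 n; rewrite -/m.
have : K1 <= Num.max K1 K2 by rewrite le_max lexx.
lra.
Qed.

Lemma cocycle_asymp_linear f (B : R) :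
    measurable_fun setT f -> (forall omega, `|f omega| <= B) ->
  {ae P, forall omega,
    asymp_linear (cocycle f ^~ omega) (\int[P]_omega f omega)}.
Proof.
move=> mf fB.
have H1 := birkhoff_sum_linear T_mp T_ergodic mf fB.
have := @birkhoff_sum_linear Tinv (f \o Tinv) B measure_preserving_inv ergodic_inv.
move=> /(_ (measurableT_comp mf Tinv_meas) (fun omega => fB _)).
rewrite (Rintegral_preserving measure_preserving_inv mf fB) => H2.
apply: filterS2 H1 H2 => omega H1 H2 eps e0.
have [K1 HK1] := H1 _ e0; have [K2 HK2] := H2 _ e0.
exists (Num.max K1 K2) => -[n|n] /=.
  by apply: le_trans (HK1 n) _; rewrite lerD2l le_max lexx.
rewrite NegzE mulrNz mulrN opprK addrC distrC normrN.
by apply: le_trans (HK2 n.+1) _; rewrite lerD2l le_max lexx orbT.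
Qed.

(** The cocycle of the indicator of [E] counts visits. It grows linearly with slope [P E > 0], so it
    cannot stay constant on a window of length about [eps * n]. *)
Lemma ae_visits (E : set Omega) : measurable E -> (0 < P E)%E ->
  {ae P, forall omega, forall C eps : R, 0 < C -> 0 < eps -> exists N : nat,
    forall n (x : int), (N <= n)%N -> `|x|%:~R <= C * n%:R ->
    exists2 z : int, `|z - x|%:~R <= eps * n%:R & E (iterz T Tinv z omega)}.
Proof.
move=> mE PE.
pose f omega : R := \1_E omega.
have mf : measurable_fun setT f by exact: measurable_indic.
have fB omega : `|f omega| <= 1.
  by rewrite /f indicE; case: (_ \in _); rewrite ?normr1 ?normr0.
have m0 : 0 < \int[P]_omega f omega.
  rewrite /Rintegral integral_indic// setIT fine_gt0// PE /=.
  by rewrite -ge0_fin_numE// fin_num_measure.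
apply: filterS (cocycle_asymp_linear mf fB) => omega; set m := Rintegral _ _ _ in m0 *.
move=> Fm C eps C0 e0.
(* The cap at 1 keeps the window length [k] below [n], as [asymp_linear_increment] demands. *)
pose e := Num.min eps 1.
have ee : 0 < e by rewrite lt_min e0 ltr01.
have me : 0 < m * e / 4 by rewrite divr_gt0 ?mulr_gt0.
have [N1 HN] := asymp_linear_increment Fm C0 me.
exists (maxn N1 (Num.truncn (2 / e)).+1) => n x; rewrite geq_max => /andP[Nn N2] xC.
have n0 : 0 <= n%:R :> R by [].
have en : 2 <= e * n%:R.
  rewrite mulrC -ler_pdivrMr//; apply: le_trans (ltW (truncnS_gt _)) _.
  by rewrite ler_nat.
pose k := Num.truncn (e * n%:R).
have kle : k%:R <= e * n%:R by rewrite truncn_le; lra.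
have kgt : e * n%:R < k%:R + 1 by rewrite natr1; exact: truncnS_gt.
have kn : (k <= n)%N.
  rewrite -(ler_nat R); apply: le_trans kle _.
  by rewrite ler_piMl// ge_min lexx orbT.
have := HN n x (x + k%:Z) Nn xC.
rewrite (_ : x + k%:Z - x = k%:Z); last by ring.
have kn' : `|k%:Z| <= n%:Z by rewrite ger0_norm// lez_nat.
move=> /(_ kn'); rewrite ler_norml => /andP[H _].
apply: contrapT => noE.
suff F0 (j : nat) : (j <= k)%N -> cocycle f (x + j%:Z) omega = cocycle f x omega.
  move: H; rewrite F0// subrr sub0r -pmulrn.
  have : m * (e * n%:R) < m * (k%:R + 1) by rewrite ltr_pM2l.
  have : m * 2 <= m * (e * n%:R) by rewrite ler_pM2l.
  lra.
elim: j => [|j IH] jk; first by rewrite addr0.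
rewrite -addn1 PoszD addrA cocycleD1 IH ?(ltnW jk)// /f indicE memNset ?addr0//.
move=> Ez; apply: noE; exists (x + j%:Z) => //.
rewrite (_ : x + j%:Z - x = j%:Z); last by ring.
apply: (@le_trans _ _ (k%:R)); first by rewrite ger0_norm// -pmulrn ler_nat ltnW.
apply: le_trans kle _; rewrite ler_wpM2r// ge_min lexx//.
Qed.

End Cocycle.

(** * The eigenfunctions *)

Section HittingFactor.
Context {d : measure_display} {Omega : measurableType d} {R : realType}.
Variable P : probability Omega R.
Variables T Tinv : Omega -> Omega.
Hypotheses (TK : cancel T Tinv) (TinvK : cancel Tinv T).
Hypotheses (T_mp : measure_preserving P T) (T_ergodic : ergodic P T).
Hypothesis Tinv_meas : measurable_fun setT Tinv.
Variable V : Omega -> R.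
Hypotheses (V_meas : measurable_fun setT V).
Hypothesis V_range : forall omega, 0 <= V omega <= 1.
Variables beta lambda : R.
Hypotheses (beta_gt0 : 0 < beta) (beta_lt : beta < lambda).

(* [hit n omega] is the expectation of [exp (\sum_(i < tau) (beta * V - lambda))]
   for the walk from 0 up to the hitting time [tau] of 1, restricted to the
   paths that stay above [-n]; decomposing the path at its first step gives
   this recursion. *)
Fixpoint hit (n : nat) (omega : Omega) : R :=
  if n is m.+1 then
    (2 * expR (lambda - beta * V omega) - hit m (Tinv omega))^-1
  else 0.

Let V0 omega : 0 <= V omega. Proof. by case/andP: (V_range omega). Qed.
Let V1 omega : V omega <= 1. Proof. by case/andP: (V_range omega). Qed.

Let gap_le omega : expR (lambda - beta) <= expR (lambda - beta * V omega).
Proof. by rewrite ler_expR lerD2l lerN2 ler_piMr// ltW. Qed.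

Let denom_ge omega (x : R) : x <= 1 ->
  expR (lambda - beta) <= 2 * expR (lambda - beta * V omega) - x.
Proof.
move=> x1; have := gap_le omega.
have : 0 < lambda - beta by rewrite subr_gt0.
have := expR_ge1Dx (lambda - beta); lra.
Qed.

(** Reaching 1 takes at least one step, and every step weighs at most [exp (beta - lambda)]. In the
    recursion this becomes [2 * a - 1 >= a] for [a = exp (lambda - beta) >= 1]. *)
Lemma hit_bound n omega : 0 <= hit n omega <= expR (- (lambda - beta)).
Proof.
elim: n omega => [|n IH] omega /=; first by rewrite lexx expR_ge0.
have h1 : hit n (Tinv omega) <= 1.
  have /andP[_] := IH (Tinv omega); move=> /le_trans; apply.
  by rewrite -expR0 ler_expR oppr_le0 subr_ge0 ltW.
have dg := denom_ge omega h1.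
have e0 := expR_gt0 (lambda - beta).
rewrite invr_ge0 expRN lef_pV2 ?posrE// ?dg ?andbT.
  exact: le_trans (ltW e0) dg.
exact: lt_le_trans e0 dg.
Qed.

Let hit_le1 n omega : hit n omega <= 1.
Proof.
have /andP[_] := hit_bound n omega; move=> /le_trans; apply.
by rewrite -expR0 ler_expR oppr_le0 subr_ge0 ltW.
Qed.

Let denom_gt0 n omega :
  0 < 2 * expR (lambda - beta * V omega) - hit n (Tinv omega).
Proof. exact: lt_le_trans (expR_gt0 _) (denom_ge omega (hit_le1 n _)). Qed.

Lemma hitS n omega : hit n omega <= hit n.+1 omega.
Proof.
elim: n omega => [|n IH] omega; first by case/andP: (hit_bound 1 omega).
rewrite [X in X <= _]/= [X in _ <= X]/= lef_pV2 ?posrE ?denom_gt0//.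
  by rewrite lerD2l lerN2.
by have := denom_gt0 n.+1 omega.
Qed.

(** Letting the floor [-n] recede gives the weight of all paths from 0 to their first visit of 1. *)
Definition hitting_factor omega : R := lim (hit n omega @[n --> \oo]).

Lemma hitting_factor_cvg omega :
  hit n omega @[n --> \oo] --> hitting_factor omega.
Proof.
apply: nondecreasing_is_cvgn.
  apply/nondecreasing_seqP => n; exact: hitS.
by exists 1 => _ [n _ <-].
Qed.

Lemma hit_le_hitting_factor n omega : hit n omega <= hitting_factor omega.
Proof.
apply: (nondecreasing_cvgn_le (u_ := hit ^~ omega)).
  by apply/nondecreasing_seqP => m; exact: hitS.
by apply/cvg_ex; eexists; exact: hitting_factor_cvg.
Qed.

Lemma hitting_factor_le omega : hitting_factor omega <= expR (- (lambda - beta)).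
Proof.
apply: limr_le; first by apply/cvg_ex; eexists; exact: hitting_factor_cvg.
by apply: nearW => n; case/andP: (hit_bound n omega).
Qed.

(** The path that steps directly to 1 already has this much weight, since [2 <= exp 1] and
    [V >= 0]. *)
Lemma hitting_factor_ge omega : expR (- (lambda + 1)) <= hitting_factor omega.
Proof.
apply: le_trans (hit_le_hitting_factor 1 omega).
rewrite /= subr0 expRN lef_pV2 ?posrE ?mulr_gt0 ?expR_gt0//.
rewrite (expRD lambda 1) mulrC ler_pM ?expR_ge0//.
  by rewrite ler_expR gerBl mulr_ge0// ltW.
by have := expR_ge1Dx (1 : R); lra.
Qed.

Lemma hitting_factor_gt0 omega : 0 < hitting_factor omega.
Proof. exact: lt_le_trans (expR_gt0 _) (hitting_factor_ge omega). Qed.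

(** This is the limit of the recursion for [hit], and also the eigenvalue equation divided by [h y],
    for [h] with [h (y + 1) / h y] the inverse hitting factor at [y]. *)
Lemma hitting_factor_eq omega :
  (hitting_factor omega)^-1 + hitting_factor (Tinv omega) =
  2 * expR (lambda - beta * V omega).
Proof.
set c := 2 * _.
suff -> : hitting_factor omega = (c - hitting_factor (Tinv omega))^-1.
  by rewrite invrK subrK.
have gT1 : hitting_factor (Tinv omega) <= 1.
  apply: le_trans (hitting_factor_le _) _.
  by rewrite -expR0 ler_expR oppr_le0 subr_ge0 ltW.
have H1 : hit n.+1 omega @[n --> \oo] --> hitting_factor omega.
  by rewrite (cvg_shiftS (hit ^~ omega)); exact: hitting_factor_cvg.
have H2 : hit n.+1 omega @[n --> \oo] --> (c - hitting_factor (Tinv omega))^-1.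
  apply: cvgV.
    rewrite gt_eqF//.
    exact: lt_le_trans (expR_gt0 _) (denom_ge omega gT1).
  by apply: cvgB; [exact: cvg_cst | exact: hitting_factor_cvg].
exact: cvg_unique H1 H2.
Qed.

Lemma measurable_hit n : measurable_fun setT (hit n).
Proof.
elim: n => [|n IH]; first exact: measurable_cst.
(* The inverse of a positive number is written [exp (- ln .)], so that measurability follows from
   that of [exp] and [ln]. *)
rewrite (_ : hit n.+1 = fun omega => expR (- ln
    (2 * expR (lambda - beta * V omega) - hit n (Tinv omega)))); last first.
  by apply/funext => omega; rewrite expRN lnK// posrE denom_gt0.
apply: measurableT_comp; first exact: measurable_expR.
apply: measurable_funN.
apply: measurableT_comp; first exact: measurable_ln.
apply: measurable_funB; last exact: measurableT_comp IH Tinv_meas.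
apply: measurable_funM; first exact: measurable_cst.
apply: measurableT_comp; first exact: measurable_expR.
apply: measurable_funB; first exact: measurable_cst.
by apply: measurable_funM; first exact: measurable_cst.
Qed.

Definition log_growth omega : R := - ln (hitting_factor omega).

Lemma measurable_log_growth : measurable_fun setT log_growth.
Proof.
apply: measurable_funN.
apply: measurableT_comp; first exact: measurable_ln.
apply: (@measurable_fun_cvg _ _ _ _ hit); first by move=> n; exact: measurable_hit.
by move=> omega _; exact: hitting_factor_cvg.
Qed.

Lemma log_growth_ge omega : lambda - beta <= log_growth omega.
Proof.
rewrite /log_growth lerNr -ler_expR lnK ?posrE ?hitting_factor_gt0//.
exact: hitting_factor_le.
Qed.

Lemma log_growth_le omega : log_growth omega <= lambda + 1.
Proof.
rewrite /log_growth lerNl -ler_expR lnK ?posrE ?hitting_factor_gt0//.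
exact: hitting_factor_ge.
Qed.

Lemma log_growth_bound omega : `|log_growth omega| <= lambda + 1.
Proof.
rewrite ger0_norm ?log_growth_le//; apply: le_trans (log_growth_ge _).
by rewrite subr_ge0 ltW.
Qed.

(** The growth exponent [alpha] of the eigenfunction, by the ergodic theorem. *)
Definition lyapunov : R := \int[P]_omega log_growth omega.

(** Its purpose is to bound by [beta + theta] the rates [lambda] whose exponent is at most
    [theta]. *)
Lemma lyapunov_ge : lambda - beta <= lyapunov.
Proof.
have -> : lambda - beta = \int[P]_omega (cst (lambda - beta)) omega.
  by rewrite Rintegral_cst// [X in fine X](@probability_setT _ _ _ P)/= mulr1.
apply: le_Rintegral => //.
- apply: (@bounded_integrable _ _ _ _ _ `|lambda - beta|) => //.
- exact: bounded_integrable measurable_log_growth log_growth_bound.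
- by move=> omega _; exact: log_growth_ge.
Qed.

(** For [y >= 0] this is the inverse of the weight of the paths from 0 to their first visit of [y];
    for [y < 0], the weight of those from [y] to their first visit of 0. *)
Definition eigenfunction omega (y : int) : R :=
  expR (cocycle T Tinv log_growth y omega).

Lemma eigenfunctionD1 omega (y : int) : eigenfunction omega (y + 1) =
  eigenfunction omega y / hitting_factor (iterz T Tinv y omega).
Proof.
rewrite /eigenfunction cocycleD1 expRD /log_growth expRN lnK//.
by rewrite posrE hitting_factor_gt0.
Qed.

Lemma eigenfunction_mono omega (y : int) :
  eigenfunction omega y <= eigenfunction omega (y + 1).
Proof.
rewrite /eigenfunction cocycleD1 ler_expR lerDl.
by apply: le_trans (log_growth_ge _); rewrite subr_ge0 ltW.
Qed.

Lemma eigenfunction_eigen omega (y : int) :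
  transfer (fun y => V (iterz T Tinv y omega)) beta (eigenfunction omega) y =
  expR lambda * eigenfunction omega y.
Proof.
rewrite /transfer eigenfunctionD1.
have -> : eigenfunction omega (y - 1) =
    eigenfunction omega y * hitting_factor (Tinv (iterz T Tinv y omega)).
  rewrite -[in RHS](subrK 1 y) eigenfunctionD1 subrK (iterzB1 TK TinvK) divfK//.
  by rewrite gt_eqF// hitting_factor_gt0.
rewrite -mulrDr hitting_factor_eq.
have -> : expR lambda = expR (beta * V (iterz T Tinv y omega)) *
   expR (lambda - beta * V (iterz T Tinv y omega)).
  by rewrite -expRD addrC subrK.
by field.
Qed.

Lemma ae_eigenfunction_growth : {ae P, forall omega,
  asymp_linear (fun y => ln (eigenfunction omega y)) lyapunov}.
Proof.
have := cocycle_asymp_linear TK T_mp T_ergodic Tinv_meas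
  measurable_log_growth log_growth_bound.
apply: filterS => omega H; rewrite /eigenfunction.
by under eq_fun do rewrite expRK.
Qed.

Lemma ae_rate_le_hitting theta : 0 <= theta -> theta < lyapunov ->
  {ae P, forall omega, rate_le (fun y => V (iterz T Tinv y omega)) beta theta lambda}.
Proof.
move=> t0 tl; apply: filterS ae_eigenfunction_growth => omega growth.
apply: (@eigenfunction_rate_le _ _ beta theta lambda lyapunov (eigenfunction omega)) => //.
- exact: ltW.
- by move=> y; exact: expR_gt0.
- exact: eigenfunction_eigen.
Qed.

Lemma ae_rate_ge_hitting theta : lyapunov <= theta ->
  {ae P, forall omega, rate_ge (fun y => V (iterz T Tinv y omega)) beta theta lambda}.
Proof.
move=> tl; apply: filterS ae_eigenfunction_growth => omega growth.
apply: (@eigenfunction_rate_ge _ _ beta theta lambda lyapunov (eigenfunction omega)) => //.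
- exact: ltW.
- by move=> y; exact: expR_gt0.
- exact: eigenfunction_mono.
- exact: eigenfunction_eigen.
Qed.

End HittingFactor.

(** * Path expectations as iterates of the transfer operator *)

Section PathExpectation.
Context {d : measure_display} {Omega : measurableType d} {R : realType}.
Variables (T Tinv : Omega -> Omega) (V : Omega -> R).

Definition cons_step n (b : bool) (s : {ffun 'I_n -> bool}) :
    {ffun 'I_n.+1 -> bool} :=
  [ffun i => if unlift ord0 i is Some j then s j else b].

Lemma sum_cons_step n (F : {ffun 'I_n.+1 -> bool} -> R) :
  \sum_s F s = \sum_(s : {ffun 'I_n -> bool}) (F (cons_step true s) + F (cons_step false s)).
Proof.
have E : \sum_s F s = \sum_b \sum_(s : {ffun 'I_n -> bool}) F (cons_step b s).
  rewrite pair_bigA /=.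
  apply: (@reindex _ _ _ _ _ (fun p : bool * {ffun 'I_n -> bool} => cons_step p.1 p.2)).
  exists (fun s : {ffun 'I_n.+1 -> bool} => (s ord0, [ffun i => s (lift ord0 i)])).
    move=> [b s] _ /=; congr pair; first by rewrite ffunE unlift_none.
    by apply/ffunP => i; rewrite !ffunE liftK.
  move=> s _; apply/ffunP => i; rewrite !ffunE /=.
  by case: unliftP => [j ->|->]; rewrite ?ffunE.
by rewrite E big_bool big_split.
Qed.

Lemma walk_path0 n x (s : {ffun 'I_n -> bool}) : walk_path x s 0 = x.
Proof. by rewrite /walk_path big_pred0 ?addr0. Qed.

Lemma walk_path_cons_step n x b (s : {ffun 'I_n -> bool}) i :
  walk_path x (cons_step b s) i.+1 = walk_path (x + walk_step b) s i.
Proof.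
rewrite /walk_path big_mkcond big_ord_recl /= ffunE unlift_none addrA.
congr (_ + _); rewrite [RHS]big_mkcond; apply: eq_bigr => j _.
by rewrite ffunE liftK /bump /= add1n ltnS.
Qed.

(** Decompose at the first step: the term of time 0 gives [exp (beta * V)] at [x], and the two
    values of the step give the average. *)
Lemma ssrw_expectationE beta theta n omega x :
  ssrw_expectation n x (path_weight T Tinv V beta theta n omega) =
  partition_function (fun y => V (iterz T Tinv y omega)) beta theta n x.
Proof.
rewrite /partition_function.
elim: n x => [|n IH] x.
  rewrite /ssrw_expectation expr0 invr1 mul1r (eq_bigr (fun=> expR (theta * x%:~R))).
    by rewrite sumr_const card_ffun card_ord expn0 mulr1n.
  by move=> s _; rewrite /path_weight big_ord0 mulr0 add0r walk_path0.
rewrite /= /transfer -!IH /ssrw_expectation sum_cons_step.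
have W b (s : {ffun 'I_n -> bool}) :
    path_weight T Tinv V beta theta n.+1 omega (walk_path x (cons_step b s)) =
    expR (beta * V (iterz T Tinv x omega)) *
    path_weight T Tinv V beta theta n omega (walk_path (x + walk_step b) s).
  rewrite /path_weight -expRD walk_path_cons_step big_ord_recl walk_path0.
  rewrite mulrDr addrA; congr (expR (_ + _ * _ + _)).
  by apply: eq_bigr => i _; rewrite walk_path_cons_step.
under eq_bigr do rewrite !W -mulrDr.
rewrite -mulr_sumr big_split /= exprS invfM.
by ring.
Qed.

Lemma policy_expectation0 (a : nat -> int -> R) n x F : policies 0 a ->
  policy_expectation a n x F = ssrw_expectation n x F.
Proof.
move=> a0; rewrite /policy_expectation /ssrw_expectation mulr_sumr.
apply: eq_bigr => s _; congr (_ * _).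
rewrite (eq_bigr (fun=> 2^-1)) ?prodr_const ?card_ord ?exprVn// => i _.
have /eqP -> : a i (walk_path x s i) == 0 by rewrite -normr_le0; exact: a0.
by rewrite mulr0 addr0 mul1r.
Qed.

(** Policies of drift bounded by 0 all give the simple walk, so the infimum is over a singleton. *)
Lemma u0E beta theta n x omega : u T Tinv V n x omega 0 beta theta =
  ln (partition_function (fun y => V (iterz T Tinv y omega)) beta theta n x).
Proof.
rewrite /u -ssrw_expectationE -[RHS]inf1; congr inf.
apply/seteqP; split => [_ [a a0 <-]|_ ->] /=.
  by rewrite policy_expectation0.
exists (fun _ _ => 0); last by rewrite policy_expectation0// => i y; rewrite normr0.
by move=> i y; rewrite normr0.
Qed.

Lemma log_momentE beta theta n omega : log_moment T Tinv V omega beta theta n =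
  n%:R^-1 * ln (partition_function (fun y => V (iterz T Tinv y omega)) beta theta n 0).
Proof. by rewrite /log_moment ssrw_expectationE. Qed.

End PathExpectation.

(** * The effective Hamiltonian *)

(** The image of a hill starting at [z] starts at [- z - l]; the extra distance [l] is at most
    [eps * n / 2] for large [n]. *)
Lemma has_hills_reflect (R : realType) (v : int -> R) :
  has_hills v -> has_hills (fun y => v (- y)).
Proof.
move=> hills c l c01 l0 C eps C0 e0.
have e20 : 0 < eps / 2 by lra.
have [N HN] := hills c l c01 l0 C _ C0 e20.
exists (maxn N (Num.truncn (2 * l%:R / eps)).+1) => n x.
rewrite geq_max => /andP[Nn N2] xC.
have ln : 2 * l%:R <= eps * n%:R.
  rewrite [leRHS]mulrC -ler_pdivrMr//; apply: le_trans (ltW (truncnS_gt _)) _.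
  by rewrite ler_nat.
have [|z zx hz] := HN n (- x) Nn; first by rewrite normrN.
exists (- z - l%:Z) => [|j jl].
  have : `|- z - l%:Z - x|%:~R <= `|z - - x|%:~R + l%:R :> R.
    by rewrite [l%:R]pmulrn -intrD ler_int; lia.
  lra.
rewrite (_ : - (- z - l%:Z + j%:Z) = z + (l - j)%N%:Z); last by lia.
by apply: hz; exact: leq_subr.
Qed.

Lemma iterz_swap d (Omega : measurableType d) (T Tinv : Omega -> Omega) (y : int) omega :
  iterz Tinv T y omega = iterz T Tinv (- y) omega.
Proof. by case: y => [[|n]|n]. Qed.

Section EffectiveHamiltonian.
Context {d : measure_display} {Omega : measurableType d} {R : realType}.
Variable P : probability Omega R.
Variable V : Omega -> R.
Hypothesis V_meas : measurable_fun setT V.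
Hypothesis V_range : forall omega, 0 <= V omega <= 1.
Variable beta : R.
Hypothesis beta_gt0 : 0 < beta.

Let V0 omega : 0 <= V omega. Proof. by case/andP: (V_range omega). Qed.

Lemma ae_has_hills T Tinv : cancel T Tinv -> cancel Tinv T ->
    measure_preserving P T -> ergodic P T -> measurable_fun setT Tinv ->
    (forall (h : R) (l : nat), 0 < h < 1 -> (0 < l)%N ->
      (0 < P [set omega | forall y : nat, (y <= l)%N ->
                            (h <= V (iterz T Tinv y%:Z omega))%R])%E) ->
  {ae P, forall omega, has_hills (fun y => V (iterz T Tinv y omega))}.
Proof.
move=> TK TinvK T_mp T_erg Tinv_meas V_hill.
(* Countably many heights, all in [(0, 1)] thanks to [k.+2], tend to 1; one null set then serves all
   heights and lengths. *)
pose c (k : nat) : R := 1 - k.+2%:R^-1.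
pose E k l := [set omega | forall y : nat, (y <= l)%N ->
                            (c k <= V (iterz T Tinv y%:Z omega))%R].
have mE k l : measurable (E k l).
  have -> : E k l = \bigcap_(y in [set y | (y <= l)%N])
      ((V \o iter y T) @^-1` `[c k, +oo[%classic).
    apply/seteqP; split => omega /= H y yl.
      by rewrite /preimage /= in_itv /= andbT; exact: H.
    by have := H y yl; rewrite /preimage /= in_itv /= andbT.
  apply: bigcap_measurable => [|y _]; first by exists 0.
  rewrite -[X in measurable X]setTI.
  have mVT : measurable_fun setT (V \o iter y T).
    apply: measurableT_comp => //; elim: y => [|y IH]; first exact: measurable_id.
    by apply: measurableT_comp IH; case: T_mp.
  by apply: mVT => //; exact: measurable_itv.
have : {ae P, forall omega, forall k l : nat, forall C eps : R, 0 < C -> 0 < eps ->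
    exists N : nat, forall n (x : int), (N <= n)%N -> `|x|%:~R <= C * n%:R ->
    exists2 z : int, `|z - x|%:~R <= eps * n%:R & E k l.+1 (iterz T Tinv z omega)}.
  apply: ae_foralln => k; apply: ae_foralln => l.
  apply: ae_visits => //.
  apply: V_hill => //; rewrite /c subr_gt0 invf_lt1// ltr1n /=.
  by rewrite gtrBl invr_gt0.
apply: filterS => omega H h l /andP[h0 h1] l0 C eps C0 e0.
pose k := Num.truncn (1 - h)^-1.
have hk : h <= c k.
  rewrite /c lerBrDl -lerBrDr -[leRHS]invrK lef_pV2 ?posrE ?invr_gt0 ?subr_gt0//.
  apply: le_trans (ltW (truncnS_gt _)) _; by rewrite ler_nat.
have [N HN] := H k l.-1 C eps C0 e0; exists N => n x Nn xC.
have [z zx hz] := HN n x Nn xC; exists z => // j jl.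
apply: le_trans hk _; rewrite (iterz_addn TinvK)//.
by apply: hz; rewrite prednK.
Qed.

(* [beta] is the growth rate of the walks that settle on a hill; a larger rate
   is achieved by ballistic walks as long as the exponent [lyapunov] of the
   eigenfunction does not exceed the tilt [theta]. *)
Lemma ae_rate T Tinv (theta : R) : cancel T Tinv -> cancel Tinv T ->
    measure_preserving P T -> ergodic P T -> measurable_fun setT Tinv ->
    {ae P, forall omega, has_hills (fun y => V (iterz T Tinv y omega))} ->
    0 <= theta ->
  exists H : R, {ae P, forall omega,
    rate_ge (fun y => V (iterz T Tinv y omega)) beta theta H /\
    rate_le (fun y => V (iterz T Tinv y omega)) beta theta H}.
Proof.
move=> TK TinvK T_mp T_erg Tinv_meas hills theta0.
(* [beta] belongs to [S] so that the supremum exists and is at least [beta] even when no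
   eigenfunction has exponent at most [theta]. *)
pose S := [set l | l = beta \/ (beta < l /\ lyapunov P Tinv V beta l <= theta)].
have Sub : has_sup S.
  split; first by exists beta; left.
  exists (beta + theta) => l [->|[bl ltheta]]; first by rewrite lerDl.
  have := lyapunov_ge P Tinv_meas V_meas V_range beta_gt0 bl; lra.
have ge_beta : beta <= sup S by apply: ub_le_sup; [case: Sub | left].
exists (sup S).
have ge_ae : {ae P, forall omega, forall k : nat,
    exists2 l : R, sup S - k.+1%:R^-1 <= l &
      rate_ge (fun y => V (iterz T Tinv y omega)) beta theta l}.
  apply: ae_foralln => k.
  have k0 : 0 < k.+1%:R^-1 :> R by rewrite invr_gt0.
  have [l [->|[bl lt]] Hl] := sup_adherent k0 Sub.
    apply: filterS hills => omega hills; exists beta; first exact: ltW.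
    by apply: hills_rate_ge.
  apply: filterS (ae_rate_ge_hitting TK TinvK T_mp T_erg Tinv_meas V_meas V_range beta_gt0 bl lt).
  by move=> omega rl; exists l => //; exact: ltW.
have le_ae : {ae P, forall omega, forall k : nat,
    rate_le (fun y => V (iterz T Tinv y omega)) beta theta (sup S + k.+1%:R^-1)}.
  apply: ae_foralln => k.
  have k0 : 0 < k.+1%:R^-1 :> R by rewrite invr_gt0.
  (* A rate above [sup S] is not in [S]; being above [beta], it has exponent greater than [theta],
     and the upper bound applies. *)
  have bl : beta < sup S + k.+1%:R^-1 by apply: le_lt_trans ge_beta _; rewrite ltrDl.
  apply: ae_rate_le_hitting => //.
  rewrite ltNge; apply/negP => lt.
  have : sup S + k.+1%:R^-1 <= sup S by apply: ub_le_sup; [case: Sub | right].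
  by rewrite gerDl leNgt k0.
have small (eps : R) : 0 < eps ->
    exists2 k : nat, k.+1%:R^-1 <= eps / 2 & True.
  move=> e0; exists (Num.truncn (eps / 2)^-1) => //.
  rewrite -[leRHS]invrK lef_pV2 ?posrE ?invr_gt0//; last by rewrite divr_gt0.
  exact: ltW (truncnS_gt _).
apply: filterS2 ge_ae le_ae => omega Hge Hle; split => C eps C0 e0.
all: have [k ke _] := small _ e0; have e20 : 0 < eps / 2 by lra.
  have [l sl Hl] := Hge k; have [N HN] := Hl C _ C0 e20.
  exists N => n x Nn xC; apply: le_trans (HN n x Nn xC).
  by rewrite lerD2r ler_wpM2r//; move: _^-1 ke sl => q ke sl; lra.
have [N HN] := Hle k C _ C0 e20.
exists N => n x Nn xC; apply: le_trans (HN n x Nn xC) _.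
by rewrite lerD2r ler_wpM2r//; move: _^-1 ke => q ke; lra.
Qed.

End EffectiveHamiltonian.

(** * From uniform rates to the scaling limit *)

Section Scaling.
Context {d : measure_display} {Omega : measurableType d} {R : realType}.
Variables (T Tinv : Omega -> Omega) (V : Omega -> R) (omega : Omega).
Variables beta theta H : R.
Let v y := V (iterz T Tinv y omega).
Hypothesis Hge : rate_ge v beta theta H.
Hypothesis Hle : rate_le v beta theta H.

Lemma log_partition_function_near (C eps : R) : 0 < C -> 0 < eps ->
  exists N : nat, forall n (x : int), (N <= n)%N -> `|x|%:~R <= C * n%:R ->
    `|ln (partition_function v beta theta n x) - (H * n%:R + theta * x%:~R)|
      <= eps * n%:R.
Proof.
move=> C0 e0; have [N1 HN1] := Hge C0 e0; have [N2 HN2] := Hle C0 e0.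
exists (maxn N1 N2) => n x; rewrite geq_max => /andP[Nn1 Nn2] xC.
have := HN1 n x Nn1 xC; have := HN2 n x Nn2 xC.
by rewrite ler_norml => ? ?; apply/andP; split; lra.
Qed.

Lemma log_moment_cvg :
  log_moment T Tinv V omega beta theta n @[n --> \oo] --> H.
Proof.
apply/cvgrPdist_le => /= e e0.
have [N HN] := log_partition_function_near ltr01 e0.
near=> n; rewrite log_momentE -/v.
have n0 : 0 < n%:R :> R by rewrite ltr0n; near: n; exact: nbhs_infty_gt.
have Nn : (N <= n)%N by near: n; exact: nbhs_infty_ge.
have /(_ _) := HN n 0 Nn; rewrite normr0 mul1r ler0n => /(_ isT).
rewrite mulr0 addr0 distrC => Hn.
rewrite -(ler_pM2r n0); apply: le_trans Hn.
by rewrite -[X in _ * X](gtr0_norm n0) -normrM mulrBl mulrAC mulVf ?mul1r// gt_eqF.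
Unshelve. all: by end_near. Qed.

Lemma scaled_u_cvg (t x : R) : 0 < t ->
  scaled_u T Tinv V omega 0 beta theta t x eps @[eps --> 0^'+] -->
  t * H + theta * x.
Proof.
move=> t0; apply/cvgrPdist_le => /= e e0.
(* For small [eps], [eps * |y| <= |x| + 1] and [eps * n >= t / 2], whence [|y| <= C * n]. *)
pose C := 2 * (`|x| + 1) / t + 1.
have x0 := normr_ge0 x.
have C0 : 0 < C by apply: ltr_wpDl => //; rewrite divr_ge0 ?ltW//; lra.
(* As [eps * n <= t], this precision leaves [e / 2] for rounding [t] and [x], which costs at most
   [(|H| + |theta|) * eps]. *)
have et : 0 < e / (2 * t) by rewrite divr_gt0 ?mulr_gt0.
have [N HN] := log_partition_function_near C0 et.
have s0 : 0 < `|H| + `|theta| + 1.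
  by have := normr_ge0 H; have := normr_ge0 theta; lra.
near=> eps.
have eps0 : 0 < eps by near: eps; exact: nbhs_right_gt.
have eps1 : eps < 1 by near: eps; apply: nbhs_right_lt.
have epst : eps < t / 2 by near: eps; apply: nbhs_right_lt; rewrite divr_gt0.
have epsN : eps < t / N.+1%:R by near: eps; apply: nbhs_right_lt; rewrite divr_gt0.
have epse : eps < e / 2 / (`|H| + `|theta| + 1).
  by near: eps; apply: nbhs_right_lt; rewrite !divr_gt0.
rewrite /scaled_u u0E -/v.
set n := Num.truncn _; set y := Num.floor _.
have n1 : eps * n%:R <= t.
  rewrite mulrC -ler_pdivlMr// mulrC truncn_le// mulr_ge0 ?invr_ge0 ?ltW//.
have n2 : t < eps * n%:R + eps.
  rewrite -{2}[eps]mulr1 -mulrDr natr1 mulrC -ltr_pdivrMr// mulrC.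
  exact: truncnS_gt.
have y1 : eps * y%:~R <= x.
  by rewrite mulrC -ler_pdivlMr// mulrC; exact: Num.Theory.floor_le.
have y2 : x < eps * y%:~R + eps.
  by rewrite -{2}[eps]mulr1 -mulrDr mulrC -ltr_pdivrMr// mulrC -intrD1 floorD1_gt.
have Nn : (N <= n)%N.
  rewrite -ltnS -(ltr_nat R) -(ltr_pM2l eps0).
  move: epsN; rewrite ltr_pdivlMr// => epsN; apply: (@lt_trans _ _ t).
    by apply: le_lt_trans epsN; rewrite ler_pM2l// ler_nat.
  by rewrite -[n.+1%:R]natr1 mulrDr mulr1.
have yC : `|y|%:~R <= C * n%:R.
  rewrite -(ler_pM2l eps0) intr_norm -{1}(gtr0_norm eps0) -normrM.
  apply: (@le_trans _ _ (`|x| + 1)).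
    have := ler_norm x; have := ler_norm (- x); rewrite normrN.
    by rewrite ler_norml => *; apply/andP; split; lra.
  rewrite mulrCA; apply: (@le_trans _ _ (C * (t / 2))).
    rewrite (_ : C * (t / 2) = `|x| + 1 + t / 2).
      by rewrite lerDl divr_ge0 ?ltW.
    by rewrite /C; field; rewrite gt_eqF.
  by rewrite ler_pM2l//; lra.
have := HN n y Nn yC; rewrite -(ler_pM2l eps0) -{1}(gtr0_norm eps0) -normrM mulrBr.
set L := eps * ln _; move=> Hn.
have {}Hn : `|L - (H * (eps * n%:R) + theta * (eps * y%:~R))| <= e / 2.
  move: Hn; rewrite mulrDr !(mulrCA eps) => /le_trans; apply.
  apply: (@le_trans _ _ (e / (2 * t) * t)); first by rewrite ler_pM2l.
  by rewrite invfM mulrA mulfVK// gt_eqF.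
move: epse; rewrite ltr_pdivlMr// => epse.
have {epse}epse : `|H| * eps + `|theta| * eps <= e / 2 by lra.
have Ht : `|H * (t - eps * n%:R)| <= `|H| * eps.
  by rewrite normrM ler_wpM2l// ler_norml; apply/andP; split; lra.
have Hx : `|theta * (x - eps * y%:~R)| <= `|theta| * eps.
  by rewrite normrM ler_wpM2l// ler_norml; apply/andP; split; lra.
move: Hn Ht Hx; rewrite !ler_norml => /andP[? ?] /andP[? ?] /andP[? ?].
by apply/andP; split; lra.
Unshelve. all: by end_near. Qed.


End Scaling.

Theorem theorem1p4 (R : realType) (d : measure_display)
    (Omega : measurableType d) (P : probability Omega R)
    (T Tinv : Omega -> Omega) (V : Omega -> R)
    (T_mp : measure_preserving P T)
    (T_ergodic : ergodic P T)
    (Tinv_meas : measurable_fun setT Tinv)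
    (TK : cancel T Tinv) (TinvK : cancel Tinv T)
    (V_meas : measurable_fun setT V)
    (V_range : forall omega, 0 <= V omega <= 1)
    (V_nonconst : ~ exists c : R, forall omega, V omega = c)
    (V_ess_inf : ess_inf P (EFin \o V) = 0%E)
    (V_ess_sup : ess_sup P (EFin \o V) = 1%E)
    (V_valley : forall (h : R) (l : nat), 0 < h < 1 -> (0 < l)%N ->
      (0 < P [set omega | forall y : nat, (y <= l)%N ->
                            (V (iterz T Tinv y%:Z omega) <= h)%R])%E)
    (V_hill : forall (h : R) (l : nat), 0 < h < 1 -> (0 < l)%N ->
      (0 < P [set omega | forall y : nat, (y <= l)%N ->
                            (h <= V (iterz T Tinv y%:Z omega))%R])%E)
    (beta theta : R) (beta_gt0 : 0 < beta) :
  exists Hbar : R, {ae P, forall omega,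
    [/\ forall t x : R, 0 < t ->
          cvg (scaled_u T Tinv V omega 0 beta theta t x eps @[eps --> 0^'+]),
        forall t x : R, 0 < t ->
          u_o T Tinv V omega 0 beta theta t x = t * Hbar + theta * x,
        effective_hamiltonian T Tinv V omega 0 beta theta = Hbar,
        cvg (log_moment T Tinv V omega beta theta n @[n --> \oo])
      & Lambda T Tinv V omega beta theta = Hbar]}.
Proof.
pose v omega y := V (iterz T Tinv y omega).
have hills := ae_has_hills V_meas TK TinvK T_mp T_ergodic Tinv_meas V_hill.
have [H rateH] : exists H : R, {ae P, forall omega,
    rate_ge (v omega) beta theta H /\ rate_le (v omega) beta theta H}.
  have [theta0|theta0] := leP 0 theta.
    exact: (ae_rate V_meas V_range beta_gt0 TK TinvK T_mp).
  have swap omega : (fun y => V (iterz Tinv T y omega)) = (fun y => v omega (- y)).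
    by apply/funext => y; rewrite iterz_swap.
  (* For [theta < 0], exchanging [T] and [Tinv] reverses the environment, and the tilt becomes
     [- theta > 0]. *)
  have [||H HH] := ae_rate (theta := - theta) V_meas V_range beta_gt0 TinvK TK
      (measure_preserving_inv TK T_mp Tinv_meas) (ergodic_inv TK T_ergodic) T_mp.1.
  - apply: filterS hills => omega; rewrite swap; exact: has_hills_reflect.
  - by rewrite oppr_ge0 ltW.
  exists H; apply: filterS HH => omega; rewrite swap => -[Hge Hle].
  by split; [exact: rate_ge_reflect | exact: rate_le_reflect].
(* The rates hold outside one null set that does not depend on [t] or [x], so all the limits hold
   there simultaneously. *)
exists H; apply: filterS rateH => omega [Hge Hle].
have scaled (t x : R) (t0 : 0 < t) := scaled_u_cvg Hge Hle (x := x) t0.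
have uo (t x : R) (t0 : 0 < t) : u_o T Tinv V omega 0 beta theta t x = t * H + theta * x.
  exact: cvg_lim (scaled t x t0).
split.
- by move=> t x t0; apply/cvg_ex; eexists; exact: scaled.
- exact: uo.
- by rewrite /effective_hamiltonian uo// mul1r mulr0 addr0.
- by apply/cvg_ex; eexists; exact: log_moment_cvg Hge Hle.
- exact: cvg_lim (log_moment_cvg Hge Hle).
Qed.
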